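(* Let $\mathcal{H}$ be a $q$-uniform linear hypergraph on $[n]$ that is maximal (i.e. no edge can be added to $\mathcal{H}$ while maintaining linearity). Then $$e(\mathcal{H}) \ge \frac{n(n-q+1)}{q(q-1)^2}=\frac{n^2}{q^3}(1-o(1)).$$
   Context: $[n]=\{1,\dots,n\}$, and $q\ge 2$ is an integer that may depend on $n$. A $q$-uniform hypergraph on $[n]$ is a set of $q$-element subsets of $[n]$, called edges; $e(\mathcal{H})$ is the number of edges of $\mathcal{H}$. A hypergraph is linear if any two distinct edges $A,B$ satisfy $|A\cap B|\le 1$. The $o(1)$ notation refers to $n\to\infty$.
   Formalization: The equality with (n^2/q^3)(1-o(1)) is false for e.g. q=2 or q=n/2, so it is stated only for q→∞ with q=o(n), exactly when it holds; the lower bound by (n^2/q^3)(1-o(1)) is given for the formula when q=o(n), and for e(H) whenever q≤n. *)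

(* Defs.v *)
From mathcomp Require Import all_boot all_order all_algebra.
From mathcomp Require Import all_classical all_reals all_analysis.

Set Implicit Arguments.
Unset Strict Implicit.
Unset Printing Implicit Defensive.

(* The vertex set [n] is rendered as 'I_n = {0, ..., n-1}. *)

Definition uniform (n q : nat) (H : {set {set 'I_n}}) : Prop :=
  forall A : {set 'I_n}, A \in H -> #|A| = q.

Definition linear_hypergraph (n : nat) (H : {set {set 'I_n}}) : Prop :=
  forall A B : {set 'I_n}, A \in H -> B \in H -> A <> B -> (#|A :&: B| <= 1)%N.

(* An edge that can be added is again a q-set, so that the enlarged hypergraph
   stays q-uniform. *)
Definition maximal_linear (n q : nat) (H : {set {set 'I_n}}) : Prop :=
  [/\ uniform q H, linear_hypergraph H &
      forall A : {set 'I_n}, #|A| = q -> A \notin H ->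
        ~ linear_hypergraph (A |: H)%SET].

Local Open Scope ring_scope.

(* The subtraction is that of R, not the truncated one of nat. *)
Definition exact_bound (R : realType) (n q : nat) : R :=
  n%:R * (n%:R - q%:R + 1) / (q%:R * (q%:R - 1) ^+ 2).

Definition main_term (R : realType) (n q : nat) : R :=
  n%:R ^+ 2 / q%:R ^+ 3.

(* Main.v *)
(* By maximality every q-set of vertices contains two vertices of a common edge,
   so the graph of covered pairs has no independent set of size q.  Turan's
   theorem for the complementary graph gives n^2 <= (q - 1) (n + 2 m), where m is
   the number of covered pairs, while m <= e(H) q (q - 1) / 2.

   The exact bound is (1 - (q - 1) / n) (q / (q - 1))^2 times n^2 / q^3, which
   handles q = o(n); if q is not small compared to n^(2/3), then n^2 / q^3 <= 1
   and a single edge is enough. *)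
Require Import Defs.
From mathcomp Require Import all_boot zify.

(* With [e] reflexive, [arcs e W] is #|W| plus twice the number of edges of the
   graph [e] induces on [W]. *)
Definition arcs {T : finType} (e : rel T) (W : {set T}) : nat :=
  (\sum_(x in W) #|[set y in W | e x y]|)%N.

(** Turan's theorem for the complement, by induction on [k]: an independent set outside the closed
    neighbourhood of [v] stays independent when [v] is added. *)
Lemma card_sqr_le_arcs {T : finType} (e : rel T) (k : nat) (W : {set T}) :
  reflexive e -> symmetric e ->
  (forall S : {set T}, S \subset W -> #|S| = k.+1 ->
     exists x y, [/\ x \in S, y \in S, x != y & e x y]) ->
  (#|W| ^ 2 <= k * arcs e W)%N.
Proof.
move=> e_refl e_sym; elim: k W => [|k IHk] W dense.
  (* For [k = 0] a singleton would have to contain two distinct vertices, so [W] is empty. *)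
  case: (set_0Vmem W) => [->|[x xW]]; first by rewrite cards0.
  have /(_ _)[||a [b [+ + + _]]] := dense [set x]; first by rewrite sub1set.
    by rewrite cards1.
  by rewrite !inE => /eqP-> /eqP->; rewrite eqxx.
case: (set_0Vmem W) => [->|[x0 x0W]]; first by rewrite cards0.
pose deg x := #|[set y in W | e x y]|.
(* Remove a vertex of minimum degree together with its neighbours. *)
have [v vW min_v] : exists2 v, v \in W & forall x, x \in W -> (deg v <= deg x)%N.
  by case: (arg_minnP deg x0W) => v vW min_v; exists v.
pose N := [set y in W | e v y].
have NW : N \subset W by apply/subsetP => x; rewrite inE => /andP[].
have IH : (#|W :\: N| ^ 2 <= k * arcs e (W :\: N))%N.
  apply: IHk => S /subsetP SWN cardS.
  have vS : v \notin S by apply/negP => /SWN; rewrite !inE vW e_refl.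
  have nbr_v x : x \in S -> e v x = false.
    by move=> /SWN; rewrite !inE => /andP[+ xW]; rewrite xW => /negbTE.
  have [||x [y [+ + xy exy]]] := dense (v |: S).
  - by rewrite subUset sub1set vW; apply/subsetP => x /SWN; rewrite inE => /andP[].
  - by rewrite cardsU1 vS cardS.
  rewrite !inE => /orP[/eqP xv|xS] /orP[/eqP yv|yS].
  - by rewrite xv yv eqxx in xy.
  - by rewrite xv nbr_v in exy.
  - by rewrite yv e_sym nbr_v in exy.
  - by exists x, y.
(* Each vertex of [N] has degree at least [deg v = #|N|]; arcs from [W :\: N] into [N] are
   dropped. *)
have arcsW : (#|N| * #|N| + arcs e (W :\: N) <= arcs e W)%N.
  rewrite /arcs [X in (_ <= X)%N](big_setID N) /= (setIidPr NW) leq_add //.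
    by rewrite -sum_nat_const leq_sum // => x xN; apply: min_v; apply: (subsetP NW).
  apply: leq_sum => x _; apply: subset_leq_card; apply/subsetP => y.
  by rewrite !inE => /andP[/andP[_ ->] ->].
have cardW : #|W| = (#|N| + #|W :\: N|)%N by rewrite -(cardsID N W) (setIidPr NW).
rewrite cardW; move: #|N| #|W :\: N| (arcs e W) (arcs e (W :\: N)) IH arcsW
  => a m P Q IH arcsW.
apply: leq_trans (leq_mul (leqnn k.+1) arcsW).
(* Cauchy-Schwarz: (a + m)^2 <= (k + 1) (a^2 + m^2 / k). *)
case: k IH {IHk dense} => [|k] IH; first by nia.
(* Multiplying by [k.+1] clears the denominator; what remains is 2xm <= x^2 + m^2 with x = (k + 1)
   a. *)
rewrite -(leq_pmul2l (ltn0Sn k)).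
have := leq_mul (leqnn k.+2) IH.
have : (2 * (k.+1 * a * m) <= (k.+1 * a) ^ 2 + m ^ 2)%N.
  by case: (nat_Cauchy (k.+1 * a) m).
nia.
Qed.

(** Otherwise [S] could be added to [H]: it is not yet an edge, since it meets itself in q >= 2
    vertices. *)
Lemma maximal_linear_covers {n q : nat} {H : {set {set 'I_n}}} {S : {set 'I_n}} :
  (2 <= q)%N -> maximal_linear q H -> #|S| = q ->
  exists2 A, A \in H & (1 < #|A :&: S|)%N.
Proof.
move=> q2 [_ linH maxH] cardS.
case: (boolP [exists A in H, (1 < #|A :&: S|)%N]) => [/exists_inP//|].
rewrite negb_exists_in => /forall_inP small.
have {}small A : A \in H -> (#|A :&: S| <= 1)%N by move=> /small; rewrite -leqNgt.
have SH : S \notin H.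
  by apply/negP => /small; rewrite setIid cardS leqNgt q2.
case: (maxH _ cardS SH) => A B; rewrite !inE.
move=> /orP[/eqP->|AH] /orP[/eqP->|BH] // AB.
- by rewrite setIC small.
- exact: small.
- exact: linH.
Qed.

Lemma maximal_linear_sqr_le {n q : nat} {H : {set {set 'I_n}}} :
  (2 <= q)%N -> maximal_linear q H ->
  (n ^ 2 <= q.-1 * (n + #|H| * (q * q.-1)))%N.
Proof.
move=> q2 maxH; have [unifH _ _] := maxH.
pose e : rel 'I_n := fun x y => (x == y) || [exists A in H, (x \in A) && (y \in A)].
have e_refl : reflexive e by move=> x; rewrite /e eqxx.
have e_sym : symmetric e.
  by move=> x y; rewrite /e eq_sym; congr orb; apply: eq_existsb => A;
    rewrite [(x \in A) && _]andbC.
have := card_sqr_le_arcs e q.-1 [set: 'I_n] e_refl e_sym.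
rewrite cardsT card_ord => /(_ _)/leq_trans; apply.
  move=> S _; rewrite prednK ?(ltnW q2) // => cardS.
  have [A AH /card_gt1P[x [y []]]] := maximal_linear_covers q2 maxH cardS.
  rewrite !inE => /andP[xA xS] /andP[yA yS] xy.
  exists x, y; split => //; apply/orP; right.
  by apply/existsP; exists A; rewrite AH xA.
rewrite leq_mul2l; apply/orP; right.
(* The 1 counts the loop at [x]; each edge through [x] contributes at most its other q - 1
   vertices. *)
have deg_le x : (#|[set y in [set: 'I_n] | e x y]| <= 1 + \sum_(A in H | x \in A) q.-1)%N.
  have -> : [set y in [set: 'I_n] | e x y] =
      (x |: \bigcup_(A in H | x \in A) (A :\ x)).
    apply/setP => y; rewrite !inE /e eq_sym; case: eqP => //= /eqP yx.
    apply/existsP/bigcupP => [[A /and3P[AH xA yA]]|[A /andP[AH xA]]].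
      by exists A; rewrite ?AH ?xA // !inE yx.
    by rewrite !inE => /andP[_ yA]; exists A; rewrite AH xA.
  apply: leq_trans (leq_card_setU _ _) _; rewrite cards1 leq_add2l.
  have -> : (\sum_(A in H | x \in A) q.-1 = \sum_(A in H | x \in A) #|A :\ x|)%N.
    by apply: eq_bigr => A /andP[AH xA]; rewrite -(unifH _ AH) (cardsD1 x A) xA.
  elim/big_rec2: _ => [|A a B _ IH]; first by rewrite cards0.
  by apply: leq_trans (leq_card_setU _ _) _; rewrite leq_add2l.
apply: leq_trans (leq_sum _ (fun x _ => deg_le x)) _.
rewrite big_split /= sum1_card cardsT card_ord leq_add2l.
(* Double counting of incidences: each edge is counted once for each of its q vertices. *)
rewrite (exchange_big_dep (mem H)) /=; last by move=> x A _ /andP[].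
rewrite -sum_nat_const leq_sum // => A AH.
rewrite sum_nat_const leq_mul2r; apply/orP; right.
by rewrite -(unifH _ AH); apply/subset_leq_card/subsetP => x; case/and3P.
Qed.

Lemma maximal_linear_card_gt0 {n q : nat} {H : {set {set 'I_n}}} :
  (2 <= q <= n)%N -> maximal_linear q H -> (0 < #|H|)%N.
Proof.
move=> /andP[q2 qn] maxH.
pose S := [set widen_ord qn i | i in [set: 'I_q]].
have cardS : #|S| = q.
  by rewrite card_imset ?cardsT ?card_ord // => i j /(congr1 val) /= /val_inj.
have [A AH _] := maximal_linear_covers q2 maxH cardS.
by apply/card_gt0P; exists A.
Qed.

From mathcomp Require Import all_order all_algebra.
From mathcomp Require Import all_classical all_reals all_analysis ring lra.
Import Order.TTheory GRing.Theory Num.Theory numFieldNormedType.Exports.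
Local Open Scope classical_set_scope.
Local Open Scope ring_scope.

Lemma exact_bound_le_card (R : realType) {n q : nat} {H : {set {set 'I_n}}} :
  (2 <= q)%N -> maximal_linear q H -> exact_bound R n q <= (#|H|)%:R.
Proof.
move=> q2 /(maximal_linear_sqr_le q2).
(* Writing the uniformity as [q.+2] turns the truncated predecessor into a true subtraction in
   [R]. *)
case: q q2 => [|[|q]] // _ /=; rewrite -(ler_nat R).
rewrite natrX natrM natrD !natrM => sqr_le.
rewrite /exact_bound -[q.+2]addn1 natrD addrK ler_pdivrMr; last first.
  by rewrite mulr_gt0 ?exprn_gt0 // ?ltr0n // -natr1 ltr0n addn1.
move: sqr_le; rewrite -[q.+2]addn1 natrD; nra.
Qed.

Lemma exact_boundE {R : realType} (n q : nat) : (2 <= q)%N ->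
  exact_bound R n q =
  main_term R n q * ((1 - (q%:R - 1) / n%:R) * (q%:R / (q%:R - 1)) ^+ 2).
Proof.
move=> q2; rewrite /exact_bound /main_term.
have q2R : 2 <= q%:R :> R by rewrite ler_nat.
(* At n = 0 the quotient by n is a default value, but both sides vanish. *)
case: n => [|n]; first by rewrite expr0n !mul0r.
have n0 : n.+1%:R != 0 :> R by rewrite pnatr_eq0.
move: (n.+1%:R) n0 => m m0.
by field; rewrite m0 /=; apply/andP; split; apply/eqP; lra.
Qed.

Lemma main_term_ge0 {R : realType} (n q : nat) : 0 <= main_term R n q.
Proof. by rewrite divr_ge0 ?exprn_ge0. Qed.

Lemma main_term_le_exact {R : realType} (n q : nat) : (2 <= q)%N ->
  main_term R n q * (1 - 4 * (q%:R / n%:R)) <= exact_bound R n q.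
Proof.
move=> q2; rewrite exact_boundE // ler_wpM2l ?main_term_ge0 //.
have q2R : 2 <= q%:R :> R by rewrite ler_nat.
have s1 : 1 <= q%:R / (q%:R - 1) :> R by rewrite ler_pdivlMr; lra.
have s2 : q%:R / (q%:R - 1) <= 2 :> R by rewrite ler_pdivrMr; lra.
have tle : (q%:R - 1) / n%:R <= q%:R / n%:R :> R.
  by rewrite ler_wpM2r ?invr_ge0 //; lra.
have t0 : 0 <= (q%:R - 1) / n%:R :> R by rewrite divr_ge0 //; lra.
move: (q%:R / (q%:R - 1)) s1 s2 => s s1 s2.
move: (q%:R / n%:R) ((q%:R - 1) / n%:R) tle t0 => u t tle t0.
have s4 : 1 <= s ^+ 2 <= 4 by apply/andP; split; nra.
move: (s ^+ 2) s4 => r /andP[r1 r4].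
(* For t <= 1 the bound r >= 1 suffices; for t > 1 the factor 1 - t is negative and r <= 4 is
   needed, whence the constant 4. *)
have [t1|/ltW t1] := leP t 1.
  have : 0 <= (1 - t) * (r - 1) by rewrite mulr_ge0 ?subr_ge0.
  lra.
have : 0 <= (t - 1) * (4 - r) by rewrite mulr_ge0 ?subr_ge0.
lra.
Qed.

Lemma mul_cvg0 {R : realType} (c : R) (u : nat -> R) :
  u n @[n --> \oo] --> (0 : R) -> c * u n @[n --> \oo] --> (0 : R).
Proof. by move=> u0; rewrite -[X in _ --> X](mulr0 c); apply: cvgMr. Qed.

Lemma natr_inv_cvg0 (R : realType) : (n%:R^-1 : R) @[n --> \oo] --> (0 : R).
Proof.
rewrite -(cvg_shiftS (fun n => n%:R^-1 : R)); exact: cvg_harmonic.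
Qed.

Lemma exact_bound_asymp {R : realType} (q : nat -> nat) : (forall n, (2 <= q n)%N) ->
  q n @[n --> \oo] --> \oo -> ((q n)%:R / n%:R : R) @[n --> \oo] --> (0 : R) ->
  exists2 eps : nat -> R, eps n @[n --> \oo] --> (0 : R) &
    forall n, exact_bound R n (q n) = main_term R n (q n) * (1 - eps n).
Proof.
move=> q2 q_large q_small.
have q2R n : 2 <= (q n)%:R :> R by rewrite ler_nat.
(* The correction factor of [exact_boundE], expressed through q/n, 1/n and 1/q, which all tend to
   0. *)
pose r n : R := (1 - ((q n)%:R / n%:R - n%:R^-1)) * (1 - (q n)%:R^-1) ^- 2.
exists (fun n => 1 - r n); last first.
  move=> n; rewrite exact_boundE // subKr /r [((q n)%:R - 1) / _]mulrBl mul1r.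
  have -> // : (q n)%:R / ((q n)%:R - 1) = (1 - (q n)%:R^-1)^-1 :> R.
    by have := q2R n => q2Rn; field; apply/andP; split; apply/eqP; lra.
  by rewrite exprVn.
have qV0 : ((q n)%:R^-1 : R) @[n --> \oo] --> (0 : R).
  exact: (cvg_comp _ _ q_large (natr_inv_cvg0 R)).
rewrite -[X in _ --> X](subrr 1); apply: cvgB; first exact: cvg_cst.
have lim1 : (1 - (0 - 0)) * (1 - 0) ^- 2 = 1 :> R.
  by rewrite !subr0 expr1n invr1 mulr1.
rewrite -[X in _ --> X]lim1 /r.
apply: cvgM.
  by apply: cvgB; [exact: cvg_cst|apply: cvgB => //; exact: (natr_inv_cvg0 R)].
apply: cvgV; first by rewrite subr0 expr1n oner_neq0.
rewrite !expr2; under eq_fun do rewrite expr2.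
by apply: cvgM; apply: cvgB => //; exact: cvg_cst.
Qed.

Lemma card_ge_main_term {R : realType} (q : nat -> nat) : (forall n, (2 <= q n)%N) ->
  exists2 eps : nat -> R, eps n @[n --> \oo] --> (0 : R) &
    forall (n : nat) (H : {set {set 'I_n}}), (q n <= n)%N ->
      maximal_linear (q n) H ->
      main_term R n (q n) * (1 - eps n) <= (#|H|)%:R.
Proof.
move=> q2.
(* When q^3 >= n^2 the main term is at most 1, and one edge suffices. *)
pose delta n : R := if (n ^ 2 <= q n ^ 3)%N then 0 else (q n)%:R / n%:R.
have delta_ge0 n : 0 <= delta n by rewrite /delta; case: ifP => // _; rewrite divr_ge0.
have delta0 : delta n @[n --> \oo] --> (0 : R).
  apply/cvgrPdist_lt => e e0.
  (* Where [delta] is not set to 0, q^3 < n^2 gives (q/n)^3 <= 1/n, so comparing cubes yields the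
     limit however q grows. *)
  have := natr_inv_cvg0 R => /cvgrPdist_lt /(_ (e ^+ 3) (exprn_gt0 _ e0)).
  apply: filterS => n; rewrite !sub0r !normrN ger0_norm ?invr_ge0 // ger0_norm //.
  rewrite /delta; case: leqP => // qn ne.
  have n0 : 0 < n%:R :> R by rewrite ltr0n; case: (n) qn => //.
  rewrite -(ltr_pXn2r (n:=3)) ?nnegrE ?divr_ge0 ?(ltW e0) //.
  apply: le_lt_trans ne; rewrite expr_div_n ler_pdivrMr ?exprn_gt0 //.
  by rewrite [n%:R ^+ 3]exprS mulKf ?gt_eqF // -!natrX ler_nat ltnW.
exists (fun n => 4 * delta n); first exact: mul_cvg0.
move=> n H qn maxH; rewrite /delta; case: ifP => large.
  rewrite mulr0 subr0 mulr1.
  apply: (@le_trans _ _ 1); last first.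
    by rewrite ler1n (maximal_linear_card_gt0 _ maxH) // q2.
  rewrite ler_pdivrMr ?mul1r -?natrX ?ler_nat // ltr0n expn_gt0.
  by rewrite (leq_trans _ (q2 n)).
exact: le_trans (main_term_le_exact n _ (q2 n)) (exact_bound_le_card R (q2 n) maxH).
Qed.

Theorem proposition1 (R : realType) :
  [/\ (* e(H) >= n(n-q+1) / (q(q-1)^2), for all n and all q >= 2 *)
      (forall (n q : nat) (H : {set {set 'I_n}}), (2 <= q)%N ->
         maximal_linear q H -> exact_bound R n q <= (#|H|)%:R),
      (* n(n-q+1) / (q(q-1)^2) = n^2/q^3 (1 - o(1)), for 1 << q << n *)
      (forall q : nat -> nat, (forall n : nat, (2 <= q n)%N) ->
         q n @[n --> \oo] --> \oo ->
         ((q n)%:R / n%:R : R) @[n --> \oo] --> (0 : R) ->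
         exists2 eps : nat -> R, eps n @[n --> \oo] --> (0 : R) &
           forall n : nat,
             exact_bound R n (q n) = main_term R n (q n) * (1 - eps n)),
      (* n(n-q+1) / (q(q-1)^2) >= n^2/q^3 (1 - o(1)), for q << n *)
      (forall q : nat -> nat, (forall n : nat, (2 <= q n)%N) ->
         ((q n)%:R / n%:R : R) @[n --> \oo] --> (0 : R) ->
         exists2 eps : nat -> R, eps n @[n --> \oo] --> (0 : R) &
           forall n : nat,
             main_term R n (q n) * (1 - eps n) <= exact_bound R n (q n)) &
      (* e(H) >= n^2/q^3 (1 - o(1)), for q <= n, uniformly in H *)
      (forall q : nat -> nat, (forall n : nat, (2 <= q n)%N) ->
         exists2 eps : nat -> R, eps n @[n --> \oo] --> (0 : R) &
           forall (n : nat) (H : {set {set 'I_n}}), (q n <= n)%N ->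
             maximal_linear (q n) H ->
             main_term R n (q n) * (1 - eps n) <= (#|H|)%:R)].
Proof.
split.
- by move=> n q H; exact: exact_bound_le_card.
- exact: exact_bound_asymp.
- move=> q q2 /(mul_cvg0 4) q_small.
  by exists (fun n => 4 * ((q n)%:R / n%:R)) => // n; exact: main_term_le_exact.
- exact: card_ge_main_term.
Qed.
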